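(* Let $\lambda,\eta,\delta\in\mathbb{R}\setminus\{0\}$ and $\sigma\in\mathbb{R}$, and let $T$ denote the solution of the initial value problem $$\dot T(t)-\sigma T(t)=-\lambda F(\delta T(t),t),\quad t>0,\qquad T(0)=\eta .$$ 1. If $F$ is defined by $F(V,t)=\nu V$, $V\in\mathbb{R}$, $t>0$, for some $\nu\in\mathbb{R}\setminus\{0\}$, then $T$ is given by $$T(t)=\eta\exp\big((\sigma-\lambda\nu\delta)t\big),\qquad t\ge 0.$$ 2. If $F$ is defined by $F(V,t)=f_1(t)+f_2(t)V$, $V\in\mathbb{R}$, $t>0$, for some $f_1,f_2\in L^1_{loc}(\mathbb{R}^+)$, then $T$ is given by $$T(t)=g_1(t)\exp(g_2(t)),\qquad t\ge 0,$$ where, for $t\ge 0$, $$g_1(t)=\eta-\lambda\int_0^t f_1(\tau)\exp\Big(\lambda\delta\int_0^\tau f_2(\xi)\,d\xi-\sigma\tau\Big)d\tau,\qquad g_2(t)=\sigma t-\lambda\delta\int_0^t f_2(\tau)\,d\tau .$$ 3. If $F$ is defined by $F(V,t)=V^n f(t)$, $V\in\mathbb{R}$, $t>0$, for some $n<1$ and some positive function $f\in L^1_{loc}(\mathbb{R}^+)$, and $\lambda$, $\delta$ and $\eta$ are positive numbers, then $T$ is given by $$T(t)=g(t)\exp(\sigma t),\qquad t\ge 0,$$ where $$g(t)=\Big(\eta^{1-n}+\lambda\delta^n(n-1)\int_0^t f(\tau)\exp(\sigma(n-1)\tau)\,d\tau\Big)^{\frac{1}{1-n}},\qquad t\ge 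0.$$
   Context: $\dot T$ denotes the derivative of $T$. The initial value problem arises as follows. Let $X(x)=\frac{\delta}{\sqrt{\sigma}}\sinh(\sqrt{\sigma}x)$ if $\sigma>0$, $X(x)=\frac{\delta}{\sqrt{|\sigma|}}\sin(\sqrt{|\sigma|}x)$ if $\sigma<0$, and $X(x)=\delta x$ if $\sigma=0$, for $x\ge 0$. With $\Phi=\lambda X$ and $h=\eta X$, the function $u(x,t)=X(x)T(t)$, $x\ge0$, $t\ge0$, is a solution with separated variables to the problem $u_t(x,t)-u_{xx}(x,t)=-\Phi(x)F(u_x(0,t),t)$ for $x>0$, $t>0$; $u(x,0)=h(x)$ for $x>0$; $u(0,t)=0$ for $t>0$.
   Formalization: Solutions are absolutely continuous and satisfy the equation a.e.; for n ≠ 0, part 3 holds on each [0,a), 0<a≤∞, where T>0 (bracket in g positive), since the formula fails after T reaches 0, e.g. n=1/2, σ=0, λ=δ=η=f=1, t>2. *)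

(* Defs.v *)
From HB Require Import structures.
From mathcomp Require Import all_boot all_order all_algebra.
From mathcomp Require Import all_classical all_reals all_analysis.
Import Order.TTheory GRing.Theory Num.Theory.
Import numFieldNormedType.Exports.

Set Implicit Arguments.
Unset Strict Implicit.
Unset Printing Implicit Defensive.

Local Open Scope classical_set_scope.
Local Open Scope ring_scope.

(* L^1_loc(R^+) with R^+ = [0, +oo[, closed at 0, so that the integrals from 0
   to t make sense; [locally_integrable] requires an open domain. *)
Definition L1loc_Rplus (R : realType) (f : R -> R) : Prop :=
  forall t : R, 0 < t ->
    (@lebesgue_measure R).-integrable `[0, t] (EFin \o f).

Definition absolutely_continuous_on (R : realType) (a b : R) (f : R -> R) :
    Prop :=
  forall e : R, 0 < e -> exists2 d : R, 0 < d &
    forall (m : nat) (x y : 'I_m -> R),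
      (forall i, [/\ a <= x i, x i <= y i & y i <= b]) ->
      trivIset [set: 'I_m] (fun i => [set` `]x i, y i[]) ->
      \sum_(i < m) (y i - x i) < d ->
      \sum_(i < m) `|f (y i) - f (x i)| < e.

(* T' - sigma T = - lambda F (delta T, t) on ]0, a[, T(0) = eta.
   F is only integrable in t, so solutions are taken in the sense of
   Caratheodory: T is locally absolutely continuous on [0, a[ and the equation
   holds almost everywhere. Values of T outside [0, a[ are irrelevant. *)
Definition ivp_solution (R : realType) (sigma lambda delta eta : R)
    (F : R -> R -> R) (a : \bar R) (T : R -> R) : Prop :=
  [/\ forall b : R, 0 < b -> (b%:E < a)%E -> absolutely_continuous_on 0 b T,
      {ae @lebesgue_measure R, forall t : R, 0 < t -> (t%:E < a)%E ->
        derivable T t 1 /\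
        derive1 T t - sigma * T t = - (lambda * F (delta * T t) t)}
    & T 0 = eta].

(* V^p for real p: the algebraic power, for V of any sign, when p is an integer
   (in particular V^0 = 1 and V^1 = V), and exp (p ln V) otherwise, which is
   meaningful for V > 0. The two agree for V > 0 (powR_intmul). *)
Definition rpow (R : realType) (V p : R) : R :=
  if p \is a Num.int then V ^ Num.floor p else V `^ p.

(* Main.v *)
(* For a linear equation, multiply T by the integrating factor; for the power
   nonlinearity, consider (T(t) exp (- sigma t))^(1 - n).  In both cases the
   result is absolutely continuous and its derivative equals almost everywhere
   that of a Lebesgue primitive, so uniqueness reduces to the fact that an
   absolutely continuous function with a.e. zero derivative is constant.  The
   latter is a Cousin-type argument: off a small open set containing the
   exceptional null set the increments are bounded by the zero derivative, on
   that set by absolute continuity.  Existence follows from the Lebesgue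
   differentiation theorem. *)
Require Import Defs.
From HB Require Import structures.
From mathcomp Require Import all_boot all_order all_algebra.
From mathcomp Require Import all_classical all_reals all_analysis.
From mathcomp Require Import measurable_realfun ring lra.
Import Order.TTheory GRing.Theory Num.Theory.
Import numFieldNormedType.Exports.
Set Implicit Arguments.
Unset Strict Implicit.
Unset Printing Implicit Defensive.
Local Open Scope classical_set_scope.
Local Open Scope ring_scope.

(** * Stability of absolute continuity under algebraic operations, [expR] and [ln] *)

Section absolute_continuity.
Context {R : realType}.
Implicit Types (a b : R) (f g h : R -> R).

(** Reduces every stability result below to a pointwise bound on increments; unary operations take
    [f] and [g] equal. *)
Lemma absolutely_continuous_comb a b f g h (K : R) :
  absolutely_continuous_on a b f -> absolutely_continuous_on a b g ->
  (forall x y, a <= x -> x <= y -> y <= b ->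
    `|h y - h x| <= K * (`|f y - f x| + `|g y - g x|)) ->
  absolutely_continuous_on a b h.
Proof.
move=> acf acg hK e e0.
(* [K] may be zero or negative; [K'] can be divided by, and [f] and [g] then each receive half of
   [e / K']. *)
pose K' := Num.max K 1.
have K'0 : 0 < K' by rewrite lt_max ltr01 orbT.
have e2 : 0 < e / (2 * K') by rewrite divr_gt0// mulr_gt0.
have [df df0 Hf] := acf _ e2.
have [dg dg0 Hg] := acg _ e2.
exists (Num.min df dg); first by rewrite lt_min df0.
move=> m x y xy triv; rewrite lt_min => /andP[sf sg].
apply: (@le_lt_trans _ _ (K' * (\sum_(i < m) `|f (y i) - f (x i)| +
                                \sum_(i < m) `|g (y i) - g (x i)|))).
  rewrite -big_split mulr_sumr; apply: ler_sum => i _.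
  have [ax xyi yb] := xy i.
  apply: le_trans (hK _ _ ax xyi yb) _.
  by rewrite ler_wpM2r ?addr_ge0// le_max lexx.
have := Hf _ _ _ xy triv sf; have := Hg _ _ _ xy triv sg => h1 h2.
rewrite mulrC -ltr_pdivlMr//.
have -> : e / K' = e / (2 * K') + e / (2 * K') by field; rewrite gt_eqF.
exact: ltrD.
Qed.

Lemma absolutely_continuous_ext a b f g :
  absolutely_continuous_on a b f ->
  (forall x, a <= x <= b -> f x = g x) -> absolutely_continuous_on a b g.
Proof.
move=> acf fg; apply: (absolutely_continuous_comb (K := 1) acf acf) => x y ax xy yb.
rewrite mul1r -!fg ?(ax, yb, le_trans ax xy, le_trans xy yb)//.
by rewrite lerDl.
Qed.

Lemma absolutely_continuous_id a b : absolutely_continuous_on a b id.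
Proof.
move=> e e0; exists e => // m x y xy _.
apply: le_lt_trans; apply: ler_sum => i _; have [_ xyi _] := xy i.
by rewrite ger0_norm ?subr_ge0.
Qed.

Lemma absolutely_continuous_cst a b (c : R) :
  absolutely_continuous_on a b (fun=> c).
Proof.
move=> e e0; exists 1 => // m x y _ _ _.
by under eq_bigr do rewrite subrr normr0; rewrite big1.
Qed.

Lemma absolutely_continuousD a b f g :
  absolutely_continuous_on a b f -> absolutely_continuous_on a b g ->
  absolutely_continuous_on a b (fun x => f x + g x).
Proof.
move=> acf acg.
apply: (absolutely_continuous_comb (K := 1) acf acg) => x y _ _ _.
by rewrite mul1r opprD addrACA ler_normD.
Qed.

Lemma absolutely_continuousZ a b f (c : R) :
  absolutely_continuous_on a b f ->
  absolutely_continuous_on a b (fun x => c * f x).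
Proof.
move=> acf.
apply: (absolutely_continuous_comb (K := `|c|) acf acf) => x y _ _ _.
by rewrite -mulrBr normrM ler_wpM2l// lerDl.
Qed.

Lemma absolutely_continuous_within a b f :
  absolutely_continuous_on a b f -> {within `[a, b], continuous f}.
Proof.
move=> acf; apply/subspace_continuousP => x /=; rewrite in_itv/= => /andP[ax xb].
apply/cvgrPdist_lt => e e0; have [d d0 fd] := acf _ e0.
(* A family consisting of one interval gives uniform continuity. *)
have small u v : a <= u -> u <= v -> v <= b -> v - u < d -> `|f v - f u| < e.
  move=> au uv vb uvd.
  have := fd 1%N (fun=> u) (fun=> v); rewrite !big_ord1; apply=> //.
  by move=> i j _ _ _; rewrite !ord1.
near=> y.
have xyd : `|x - y| < d.
  by near: y; apply: (@cvgr_dist_lt _ R^o) => //; exact: cvg_within.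
have : y \in `[a, b] by near: y; exact: withinT.
rewrite in_itv/= => /andP[ay yb].
have [xy|/ltW yx] := leP x y.
  rewrite distrC; apply: small => //; apply: le_lt_trans xyd.
  by rewrite distrC ler_norm.
by apply: small => //; apply: le_lt_trans xyd; rewrite ler_norm.
Unshelve. all: by end_near. Qed.

Lemma absolutely_continuous_bounded a b f :
  absolutely_continuous_on a b f ->
  exists2 M, 0 < M & forall x, a <= x -> x <= b -> `|f x| <= M.
Proof.
have [ab|ba] := leP a b; last first.
  by exists 1 => // x ax xb; have := lt_le_trans ba (le_trans ax xb); rewrite ltxx.
move=> /absolutely_continuous_within cf.
have [c _ fc] := EVT_max ab cf; have [d _ fd] := EVT_min ab cf.
exists (`|f c| + `|f d| + 1) => [|x ax xb]; first by rewrite ltr_wpDl.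
have xab : x \in `[a, b] by rewrite in_itv/= ax.
have := fc _ xab; have := fd _ xab.
have := ler_norm (f c); have := ler_norm (- f d); rewrite normrN.
have := normr_ge0 (f c); have := normr_ge0 (f d).
by move=> ? ? ? ? ? ?; rewrite ler_norml; apply/andP; split; lra.
Qed.

Lemma absolutely_continuousM a b f g :
  absolutely_continuous_on a b f -> absolutely_continuous_on a b g ->
  absolutely_continuous_on a b (fun x => f x * g x).
Proof.
move=> acf acg.
have [M M0 fM] := absolutely_continuous_bounded acf.
have [N N0 gN] := absolutely_continuous_bounded acg.
apply: (absolutely_continuous_comb (K := M + N) acf acg) => x y ax xy yb.
have -> : f y * g y - f x * g x = (f y - f x) * g y + f x * (g y - g x) by ring.
apply: (le_trans (ler_normD _ _)); rewrite !normrM.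
have := fM _ ax (le_trans xy yb); have := gN _ (le_trans ax xy) yb.
have := normr_ge0 (f y - f x); have := normr_ge0 (g y - g x).
by have := normr_ge0 (g y); have := normr_ge0 (f x); nra.
Qed.

(** [f] is bounded by some [M], and [expR] is Lipschitz with constant [expR M] below [M], because
    [1 + (u - v) <= expR (u - v)]. *)
Lemma absolutely_continuous_expR a b f :
  absolutely_continuous_on a b f ->
  absolutely_continuous_on a b (fun x => expR (f x)).
Proof.
move=> acf; have [M M0 fM] := absolutely_continuous_bounded acf.
have lip u v : u <= v -> v <= M -> `|expR v - expR u| <= expR M * (v - u).
  move=> uv vM; rewrite ger0_norm; last by rewrite subr_ge0 ler_expR.
  have : expR u = expR v * expR (u - v) by rewrite -expRD subrKC.
  have := expR_ge1Dx (u - v); have := expR_gt0 v.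
  have : expR v <= expR M by rewrite ler_expR.
  by move=> ? ? ? ->; nra.
apply: (absolutely_continuous_comb (K := expR M) acf acf) => x y ax xy yb.
apply: (@le_trans _ _ (expR M * `|f y - f x|)); last first.
  by rewrite ler_wpM2l ?expR_ge0// lerDl.
have /ler_normlP[_ fxM] := fM _ ax (le_trans xy yb).
have /ler_normlP[_ fyM] := fM _ (le_trans ax xy) yb.
have [fxy|/ltW fyx] := leP (f x) (f y).
  by rewrite [X in _ <= _ * X]ger0_norm ?subr_ge0//; exact: lip.
by rewrite distrC [in leRHS]distrC [X in _ <= _ * X]ger0_norm ?subr_ge0//; exact: lip.
Qed.

(** By compactness [f] has a positive minimum [m], and [ln] is Lipschitz with constant [m^-1] above
    [m]. *)
Lemma absolutely_continuous_ln a b f :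
  (forall x, a <= x -> x <= b -> 0 < f x) ->
  absolutely_continuous_on a b f ->
  absolutely_continuous_on a b (fun x => ln (f x)).
Proof.
move=> f0 acf.
have [m m0 fm] : exists2 m, 0 < m & forall x, a <= x -> x <= b -> m <= f x.
  have [ab|ba] := leP a b; last first.
    by exists 1 => // x ax xb; have := lt_le_trans ba (le_trans ax xb); rewrite ltxx.
  have [c] := EVT_min ab (absolutely_continuous_within acf).
  rewrite in_itv/= => /andP[ac cb] fc.
  by exists (f c) => [|x ax xb]; [exact: f0|apply: fc; rewrite in_itv/= ax].
have lip u v : m <= u -> u <= v -> `|ln v - ln u| <= m^-1 * (v - u).
  move=> mu uv; have u0 := lt_le_trans m0 mu; have v0 := lt_le_trans u0 uv.
  rewrite ger0_norm; last by rewrite subr_ge0 ler_ln// posrE.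
  rewrite -ln_div ?posrE//.
  have -> : v / u = 1 + (v - u) / u by field; rewrite gt_eqF.
  have vu : 0 <= (v - u) / u by rewrite divr_ge0 ?subr_ge0// ltW.
  apply: (@le_trans _ _ ((v - u) / u)).
    by apply: le_ln1Dx; apply: lt_le_trans vu; rewrite ltrN10.
  by rewrite mulrC ler_wpM2r ?subr_ge0// lef_pV2// posrE.
apply: (absolutely_continuous_comb (K := m^-1) acf acf) => x y ax xy yb.
apply: (@le_trans _ _ (m^-1 * `|f y - f x|)); last first.
  by rewrite ler_wpM2l ?invr_ge0 ?lerDl// ltW.
have fxm := fm _ ax (le_trans xy yb).
have fym := fm _ (le_trans ax xy) yb.
have [fxy|/ltW fyx] := leP (f x) (f y).
  by rewrite [X in _ <= _ * X]ger0_norm ?subr_ge0//; exact: lip.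
by rewrite distrC [in leRHS]distrC [X in _ <= _ * X]ger0_norm ?subr_ge0//; exact: lip.
Qed.

End absolute_continuity.

(** Compactness of [[a, b]] as an induction principle: at the supremum of the points satisfying [P],
    the step carries [P] from a point just before it to a point beyond it, unless the supremum is
    [b]. *)
Lemma itv_induction (R : realType) (a b : R) (P : R -> Prop) :
  a <= b -> P a ->
  (forall c, a <= c <= b -> exists2 r, 0 < r &
    forall s t, a <= s <= c -> c <= t <= b -> c - r < s -> t < c + r ->
      P s -> P t) ->
  P b.
Proof.
move=> ab Pa step; pose E := [set x | [/\ a <= x, x <= b & P x]].
have supE : has_sup E.
  by split; [exists a | exists b => x []].
have Ea : E a by [].
have ac : a <= sup E by apply: ub_le_sup => //; case: supE.
have cb : sup E <= b by apply: ge_sup => [|x []//]; case: supE.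
have [|r r0 Pr] := step (sup E); first by rewrite ac.
have [s [as_ sb Ps] crs] := sup_adherent r0 supE.
have sc : s <= sup E by apply: ub_le_sup => //; case: supE.
pose t := Num.min b (sup E + r / 2).
have ct : sup E <= t by rewrite le_min cb lerDl divr_ge0// ltW.
have tb : t <= b by rewrite ge_min lexx.
have Pt : P t.
  apply: (Pr s t) => //; rewrite ?as_ ?ct//.
  by rewrite gt_min ltrD2l ltr_pdivrMr// mulr_natr mulr2n ltrDl r0 orbT.
have : t <= sup E.
  by apply: ub_le_sup; [case: supE|split=> //; exact: le_trans ct].
rewrite /t ge_min => /orP[bc|].
  suff : t = b by move=> <-.
  by apply/eqP; rewrite eq_le tb (le_trans bc).
by rewrite gerDl leNgt divr_gt0.
Qed.

(** * Absolutely continuous functions with almost everywhere zero derivative *)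

Section derivative_zero.
Context {R : realType}.
Notation mu := (@lebesgue_measure R).

Lemma measurable_itvs (m : nat) (x y : 'I_m -> R) :
  measurable (\big[setU/set0]_(i < m) [set` `]x i, y i[] : set R).
Proof. by apply: bigsetU_measurable => i _; exact: measurable_itv. Qed.

Lemma lebesgue_measure_itvs (m : nat) (x y : 'I_m -> R) :
  (forall i, x i <= y i) ->
  trivIset [set: 'I_m] (fun i => [set` `]x i, y i[]) ->
  mu (\big[setU/set0]_(i < m) [set` `]x i, y i[]) =
  (\sum_(i < m) (y i - x i))%:E.
Proof.
(* The measure is read as the integral of 1, which is additive over the disjoint family. *)
move=> xy triv; rewrite -[LHS]mul1e -integral_cst; last exact: measurable_itvs.
rewrite ge0_integral_bigsetU//=; last 2 first.
- exact: index_enum_uniq.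
- exact: sub_trivIset triv.
rewrite -sumEFin; apply: eq_bigr => i _.
rewrite integral_cst// mul1e; apply: etrans (lebesgue_measure_itv _) _ => /=.
rewrite lte_fin.
by case: ltgtP (xy i) => // ->; rewrite subrr.
Qed.

(** Outer regularity, applied to a measurable null set containing [N]. *)
Lemma negligible_sub_open (N : set R) (d : R) : mu.-negligible N -> 0 < d ->
  exists U : set R, [/\ open U, N `<=` U & (mu U < d%:E)%E].
Proof.
move=> [A [mA muA NA]] d0; have A0 : mu A = 0 := muA.
have Aoo : (mu A < +oo)%E by rewrite A0.
have [U [oU AU Ud]] := lebesgue_regularity_outer mA Aoo d0.
exists U; split => //; first exact: subset_trans AU.
have mU : measurable U by exact: open_measurable.
apply: le_lt_trans Ud.
have := measureU2 mu (measurableD mU mA) mA.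
by rewrite setDKU// [X in (_ <= _ + X)%E]A0 adde0.
Qed.

Lemma is_derive0_le (f : R -> R) (c e : R) : is_derive c 1 f 0 -> 0 < e ->
  exists2 r, 0 < r & forall y, `|y - c| < r -> `|f y - f c| <= e * `|y - c|.
Proof.
move=> [df f'] e0.
have : h^-1 *: (f (h *: 1 + c) - f c) @[h --> 0^'] --> 'D_1 f c by exact: df.
rewrite f' => /cvgrPdist_lt/(_ _ e0)[r /= r0 fr].
exists r => // y yr; have [->|yc] := eqVneq y c; first by rewrite !subrr normr0 mulr0.
have yc0 : y - c != 0 by rewrite subr_eq0.
have := fr (y - c); rewrite /= !sub0r !normrN => /(_ yr yc0).
rewrite scaler1 subrK normrM normfV mulrC ltr_pdivrMr ?normr_gt0//.
exact: ltW.
Qed.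

Lemma absolutely_continuous_derive0 (a b : R) (f : R -> R) : a <= b ->
  absolutely_continuous_on a b f ->
  {ae mu, forall t, a < t < b -> is_derive t 1 f 0} -> f b = f a.
Proof.
move=> ab acf df0; apply/eqP; rewrite -subr_eq0 -normr_le0.
apply/ler_addgt0Pr => r r0; rewrite add0r.
(* Chosen so that [e * (b - a) + e = r]: the first term pays for the points of zero derivative, the
   second for the variation over [U]. The added 1 also covers [a = b]. *)
pose e := r / (b - a + 1).
have ba1 : 0 < b - a + 1 by rewrite ltr_wpDl ?subr_ge0.
have e0 : 0 < e by rewrite divr_gt0.
have [d d0 fd] := acf _ e0.
(* The end points join the exceptional set, since the derivative is only known inside []a, b[]. *)
have [U [oU NU Ud]] : exists U : set R,
    [/\ open U, [set t | ~ (a < t < b -> is_derive t 1 f 0)] `|` [set a; b] `<=` U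
      & (mu U < d%:E)%E].
  apply: negligible_sub_open => //; apply: negligibleU => //.
  have neg1 c : mu.-negligible [set c].
    by exists [set c]; split => //; exact: lebesgue_measure_set1.
  exact: negligibleU.
(* [P x]: the increment of f on [a, x] is at most e (x - a) plus the variation
   over finitely many disjoint subintervals of the small open set U. *)
pose P (x : R) := exists m (u v : nat -> R),
  [/\ forall i, (i < m)%N -> [/\ a <= u i, u i <= v i & v i <= x],
      forall i, (i < m)%N -> `]u i, v i[ `<=` U,
      trivIset [set: 'I_m] (fun i : 'I_m => [set` `]u i, v i[])
    & `|f x - f a| <= e * (x - a) + \sum_(i < m) `|f (v i) - f (u i)| ].
(* Crossing an interval inside [U] appends it at index [m]; it is disjoint from the earlier ones,
   which end at or before [x]. *)
have extU x y : a <= x -> x <= y -> `]x, y[ `<=` U -> P x -> P y.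
  move=> ax xy xyU [m [u [v [auv uvU triv fx]]]].
  exists m.+1, (fun i => if (i < m)%N then u i else x),
    (fun i => if (i < m)%N then v i else y); split.
  - move=> i _; case: ifPn => [/auv[? ? ?]|_]; last by [].
    by split => //; exact: le_trans xy.
  - by move=> i _; case: ifPn => // /uvU.
  - move=> i j _ _ [z []] /=.
    have [im|im] := boolP (i < m)%N; have [jm|jm] := boolP (j < m)%N.
    + move=> zi zj; apply: ord_inj.
      by have /(congr1 val) := triv (Ordinal im) (Ordinal jm) I I
        (ex_intro _ z (conj zi zj)).
    + rewrite !in_itv/= => /andP[_ zv] /andP[xz _].
      have [_ _ vx] := auv _ im.
      by have := lt_le_trans (lt_trans xz zv) vx; rewrite ltxx.
    + rewrite !in_itv/= => /andP[xz _] /andP[_ zv].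
      have [_ _ vx] := auv _ jm.
      by have := lt_le_trans (lt_trans xz zv) vx; rewrite ltxx.
    + move=> _ _; move: im jm; rewrite -!leqNgt => mi mj.
      apply: ord_inj; apply/eqP; rewrite eqn_leq.
      by rewrite (leq_trans (ltnSE (ltn_ord i)) mj) (leq_trans (ltnSE (ltn_ord j)) mi).
  - rewrite big_ord_recr/= ltnn.
    under eq_bigr do rewrite ltn_ord.
    have -> : f y - f a = (f x - f a) + (f y - f x) by ring.
    apply: le_trans (ler_normD _ _) _; rewrite addrA lerD2r.
    apply: le_trans fx _; rewrite lerD2r ler_pM2l// lerD2r//.
(* Crossing an interval of small slope keeps the family and is charged to the linear term. *)
have ext x y : a <= x -> x <= y -> `|f y - f x| <= e * (y - x) -> P x -> P y.
  move=> ax xy fxy [m [u [v [auv uvU triv fx]]]].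
  exists m, u, v; split => //.
    by move=> i /auv[? ? ?]; split => //; exact: le_trans xy.
  have -> : f y - f a = (f x - f a) + (f y - f x) by ring.
  apply: le_trans (ler_normD _ _) _.
  by apply: le_trans (lerD fx fxy) _; rewrite addrAC -mulrDr [x - a + _]addrC subrKA.
have Pb : P b.
  apply: (itv_induction ab).
    exists 0%N, (fun=> 0), (fun=> 0); split => //; first by move=> [].
    by rewrite big_ord0 !subrr mulr0 addr0 normr0.
  move=> c /andP[ac cb].
  (* If [c] lies in [U], a whole neighbourhood does and [extU] applies. Otherwise the derivative at
     [c] is zero; that bound is centred at [c], so [s] to [c] and [c] to [t] are crossed
     separately. *)
  have [Uc|NUc] := pselect (U c).
    have [q /= q0 qU] := oU _ Uc.
    exists q => // s t /andP[as_ sc] /andP[ct tb] qs tq.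
    apply: extU => //; first exact: le_trans ct.
    move=> z /=; rewrite in_itv/= => /andP[sz zt]; apply: qU => /=.
    by rewrite ltr_distlC (lt_trans qs sz) (lt_trans zt tq).
  have : is_derive c 1 f 0.
    apply: contrapT => Ndf; apply: (NUc); apply: (NU); left => /= df; apply: Ndf.
    apply: df; rewrite !lt_neqAle ac cb !andbT; apply/andP.
    by split; apply: contra_notN NUc => /eqP cab; apply: NU; right; [left|right].
  move=> /is_derive0_le/(_ e0)[q q0 fq].
  exists q => // s t /andP[as_ sc] /andP[ct tb] qs tq Ps.
  apply: (ext c t) => //.
    by rewrite -[X in _ * X]ger0_norm ?subr_ge0// fq// ger0_norm ?subr_ge0// ltrBlDl.
  apply: (ext s c) => //.
  rewrite -[X in _ * X]ger0_norm ?subr_ge0// distrC [X in _ * X]distrC fq//.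
  by rewrite distrC ger0_norm ?subr_ge0// ltrBlDl -ltrBlDr.
have [m [u [v [auv uvU triv]]]] := Pb; move/le_trans; apply.
have -> : r = e * (b - a) + e
  by rewrite -[X in _ + X]mulr1 -mulrDr /e divfK// gt_eqF.
(* The disjoint intervals lie in [U], so their total length is below [d]. *)
rewrite lerD2l ltW//; apply: fd => //; first by move=> i; exact: auv.
rewrite -lte_fin -lebesgue_measure_itvs//; last by move=> i; have [] := auv i (ltn_ord i).
apply: le_lt_trans Ud; apply: le_measure; rewrite ?inE//; first exact: measurable_itvs.
  exact: open_measurable.
apply: (big_ind (fun A => A `<=` U)) => [//|A B AU BU|i _].
  by rewrite subUset.
exact: uvU.
Qed.

End derivative_zero.

(** * Lebesgue primitives of locally integrable functions *)

Section primitive.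
Context {R : realType}.
Notation mu := (@lebesgue_measure R).
Implicit Types (a b : R) (f g h : R -> R).

Lemma L1loc_Rplus_restrict f b : L1loc_Rplus f -> 0 < b ->
  mu.-integrable setT (EFin \o f \_ `[0, b]).
Proof. by move=> f1 b0; rewrite -restrict_EFin -integrable_mkcond//; exact: f1. Qed.

Lemma Rintegral_primitiveB f x y : L1loc_Rplus f -> 0 <= x -> x <= y ->
  \int[mu]_(t in `[0, y]) f t - \int[mu]_(t in `[0, x]) f t =
  \int[mu]_(t in `]x, y[) f t.
Proof.
move=> f1 x0; rewrite le_eqVlt => /predU1P[<-|xy].
  by rewrite subrr set_itvoo0 Rintegral_set0.
have intf := f1 _ (le_lt_trans x0 xy).
rewrite Rintegral_itvB ?bnd_simp ?(ltW xy)//.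
rewrite [RHS]Rintegral_itv_bndo_bndc//.
by apply: integrableS intf => //; apply: subset_itv; rewrite bnd_simp.
Qed.

(** The increments are bounded by the integral of the absolute value over the union of the
    intervals, which is small when the measure of the union is small. *)
Lemma primitive_absolutely_continuous f b : L1loc_Rplus f -> 0 < b ->
  absolutely_continuous_on 0 b (fun t => \int[mu]_(s in `[0, t]) f s).
Proof.
move=> f1 b0 e e0; have intfb := L1loc_Rplus_restrict f1 b0.
have [d [d0 fd]] := integral_normr_continuous intfb e0.
exists d => // m x y xy triv xyd.
have xyi i : x i <= y i by have [] := xy i.
have /(fd _ (measurable_itvs _ _)) :
    (mu (\big[setU/set0]_(i < m) [set` `]x i, y i[]) < d%:E)%E.
  by rewrite lebesgue_measure_itvs// lte_fin.
apply: le_lt_trans.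
have intnfb : mu.-integrable setT (EFin \o (fun t => `|(f \_ `[0, b]) t|)).
  exact: (integrable_norm intfb).
apply: (@le_trans _ _
    (\sum_(i < m) \int[mu]_(t in `]x i, y i[) `|(f \_ `[0, b]) t|)).
  apply: ler_sum => i _; have [xi _ yi] := xy i.
  rewrite Rintegral_primitiveB//.
  have fE : {in `]x i, y i[, f =1 f \_ `[0, b]}.
    move=> t; rewrite in_itv/= => /andP[xt ty].
    rewrite patchE mem_set//= in_itv/=.
    by rewrite (le_trans xi (ltW xt)) (le_trans (ltW ty) yi).
  rewrite (@eq_Rintegral _ _ _ mu _ (f \_ `[0, b])); last first.
    by move=> t; rewrite inE => /fE.
  apply: le_normr_Rintegral => //.
  exact: integrableS intfb.
rewrite le_eqVlt; apply/orP; left; apply/eqP/EFin_inj.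
rewrite -sumEFin [in RHS]/Rintegral fineK; last first.
  apply: integrable_fin_num; first exact: measurable_itvs.
  by apply: integrableS intnfb => //; exact: measurable_itvs.
rewrite (integral_bigsetU_EFin mu)//=; last 3 first.
- exact: index_enum_uniq.
- exact: sub_trivIset triv.
- by apply: measurable_funS (measurable_int _ intnfb).
apply: eq_bigr => i _; rewrite /Rintegral fineK//.
by apply: integrable_fin_num => //; exact: integrableS intnfb.
Qed.

(** Lebesgue differentiation applies to the truncations of [f] to [[0, n + 1]], which are integrable
    on the whole line; countably many null sets are then discarded together. *)
Lemma is_derive_primitive f : L1loc_Rplus f ->
  {ae mu, forall t : R, 0 < t ->
    is_derive t 1 (fun t => \int[mu]_(s in `[0, t]) f s) (f t)}.
Proof.
move=> f1.
have ae_n (n : nat) : {ae mu, forall t : R, 0 < t < n%:R ->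
    is_derive t 1 (fun t => \int[mu]_(s in `[0, t]) f s) (f t)}.
  case: n => [|n].
    by apply: aeW => t /andP[t0 /(lt_trans t0)]; rewrite ltxx.
  pose fn := f \_ `[0, n.+1%:R].
  have intfn : mu.-integrable setT (EFin \o fn).
    exact: (L1loc_Rplus_restrict f1 (ltr0Sn _ _)).
  have locfn : locally_integrable setT fn.
    by apply: integrable_locally => //; exact: f1.
  have intfny (y : R) :
      mu.-integrable [set` Interval (BLeft 0) (BRight y)] (EFin \o fn).
    exact: integrableS intfn.
  have := FTC1 intfny locfn.
  apply: (@filterS _ _ (ae_filter_ringOfSetsType mu)) => t dft /andP[t0 tn].
  have [//|dfn dfnE] := dft.
  have -> : f t = fn t by rewrite /fn patchE mem_set//= in_itv/= !ltW.
  rewrite -dfnE derive1E.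
  apply: near_eq_is_derive (DeriveDef dfn erefl).
  (* Since [t < n + 1], the primitives of [f] and of its truncation agree near [t]. *)
  near=> s; apply: eq_Rintegral => u; rewrite inE/= in_itv/= => /andP[u0 us].
  rewrite /fn patchE mem_set//= in_itv/= u0 (le_trans us)//.
  by near: s; exact: lt_le_nbhsl.
move: ae_n => /ae_foralln.
apply: (@filterS _ _ (ae_filter_ringOfSetsType mu)) => t dft t0.
by apply: (dft _); rewrite t0/=; exact: truncnS_gt.
Unshelve. all: by end_near. Qed.

(** On each [[0, t]] the factor [h] is continuous, hence measurable and bounded. *)
Lemma L1loc_RplusM f h : L1loc_Rplus f ->
  (forall b, 0 < b -> absolutely_continuous_on 0 b h) ->
  L1loc_Rplus (fun t => f t * h t).
Proof.
move=> f1 ach t t0.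
have [M M0 hM] := absolutely_continuous_bounded (ach t t0).
apply: (integrableMl _ (f1 t t0)) => //.
  apply: subspace_continuous_measurable_fun => //.
  exact: absolutely_continuous_within (ach t t0).
exists M; split; first exact: num_real.
move=> N MN s /=; rewrite in_itv/= => /andP[s0 st].
by apply: le_trans (ltW MN); exact: hM.
Qed.

Lemma L1loc_Rplus_cst (c : R) : L1loc_Rplus (fun=> c).
Proof.
move=> t t0; apply: measurable_bounded_integrable => //.
  by rewrite /= lebesgue_measure_itv/= lte_fin t0 ltry.
exists `|c|; split; first exact: num_real.
by move=> N cN s _ /=; exact: ltW.
Qed.

End primitive.

Lemma powRE (R : realType) (x p : R) : 0 < x -> x `^ p = expR (p * ln x).
Proof. by move=> x0; rewrite /powR gt_eqF. Qed.

Lemma rpow_gt0E (R : realType) (x p : R) : 0 < x -> rpow x p = x `^ p.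
Proof.
rewrite /rpow; case: ifPn => // pint x0.
by rewrite -powR_intmul ?(ltW x0)// floorK.
Qed.

(** * Comparison of derivatives and the linear initial value problem *)

Section ivp.
Context {R : realType}.
Notation mu := (@lebesgue_measure R).
Implicit Types (a : \bar R) (f g : R -> R).

Lemma is_derive_funD f g (t df dg : R) :
  is_derive t 1 f df -> is_derive t 1 g dg ->
  is_derive t 1 (fun s => f s + g s) (df + dg).
Proof. exact: is_deriveD. Qed.

Lemma is_derive_funZ f (c t df : R) : is_derive t 1 f df ->
  is_derive t 1 (fun s => c * f s) (c * df).
Proof. exact: is_deriveZ. Qed.

Lemma is_derive_funM f g (t df dg : R) :
  is_derive t 1 f df -> is_derive t 1 g dg ->
  is_derive t 1 (fun s => f s * g s) (f t * dg + g t * df).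
Proof. exact: is_deriveM. Qed.

(** The uniqueness tool for both equations: [f - g] is absolutely continuous with zero derivative
    almost everywhere. *)
Lemma absolutely_continuous_derive_eq (b : R) f g : 0 < b ->
  absolutely_continuous_on 0 b f -> absolutely_continuous_on 0 b g ->
  {ae mu, forall t : R, 0 < t < b ->
    exists2 l, is_derive t 1 f l & is_derive t 1 g l} ->
  f 0 = g 0 -> f b = g b.
Proof.
move=> b0 acf acg dfg fg0.
have := absolutely_continuousD acf (absolutely_continuousZ (-1) acg).
move=> /(absolutely_continuous_derive0 (ltW b0)) fgb.
apply/eqP; rewrite -subr_eq0 -mulN1r fgb ?fg0 ?mulN1r ?subrr//.
apply: (@filterS _ _ (ae_filter_ringOfSetsType mu)) dfg => t dfg /dfg[l df dg].
apply: (is_derive_eq (is_derive_funD df (is_derive_funZ (-1) dg))).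
by rewrite mulN1r subrr.
Qed.

Lemma is_derive_expR_comp f (t df : R) : is_derive t 1 f df ->
  is_derive t 1 (fun s => expR (f s)) (expR (f t) * df).
Proof. by move=> hf; exact: (is_derive1_comp (is_derive_expR (f t)) hf). Qed.

Lemma is_derive_ln_comp f (t df : R) : 0 < f t -> is_derive t 1 f df ->
  is_derive t 1 (fun s => ln (f s)) ((f t)^-1 * df).
Proof. by move=> ft0 hf; exact: (is_derive1_comp (is_derive1_ln ft0) hf). Qed.

Lemma lt_between_ereal a (t : R) : (t%:E < a)%E ->
  exists2 b : R, t < b & (b%:E < a)%E.
Proof.
case: a => [r|_|//]; last by exists (t + 1); rewrite ?ltrDl ?ltry.
rewrite lte_fin => tr; exists ((t + r) / 2); rewrite ?lte_fin; lra.
Qed.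

(** A solution is prescribed only on [[0, a[]; an interior point has a neighbourhood inside, which
    is enough to transport the derivative. *)
Lemma is_derive_on_eq a f g (t df : R) :
  (forall s : R, 0 <= s -> (s%:E < a)%E -> f s = g s) ->
  0 < t -> (t%:E < a)%E -> is_derive t 1 g df -> is_derive t 1 f df.
Proof.
move=> fg t0 /lt_between_ereal[b tb ba]; apply: near_eq_is_derive.
near=> s; apply/esym/fg.
  by apply: ltW; near: s; exact: lt_nbhsr.
by apply: le_lt_trans ba; rewrite lee_fin ltW//; near: s; exact: lt_nbhsl.
Unshelve. all: by end_near. Qed.

Lemma ivp_solutionE (sigma lambda delta eta : R) (F : R -> R -> R) a
    (T : R -> R) :
  ivp_solution sigma lambda delta eta F a T <->
  [/\ forall b : R, 0 < b -> (b%:E < a)%E -> absolutely_continuous_on 0 b T,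
      {ae mu, forall t : R, 0 < t -> (t%:E < a)%E ->
        is_derive t 1 T (sigma * T t - lambda * F (delta * T t) t)}
    & T 0 = eta].
Proof.
split=> -[acT dT T0]; split=> //;
    apply: (@filterS _ _ (ae_filter_ringOfSetsType mu)) dT => t + t0 ta.
  move=> /(_ t0 ta)[dT T']; apply: DeriveDef => //.
  by rewrite -derive1E; lra.
by move=> /(_ t0 ta)[dT T']; split=> //; rewrite derive1E T'; lra.
Qed.

(** The equivalence contains both uniqueness (left to right) and existence. Allowing any [a] makes
    it serve the power equation with exponent zero as well. *)
Lemma linear_ivp_solution (sigma lambda delta eta : R) (F : R -> R -> R)
    f1 f2 a (T : R -> R) :
  L1loc_Rplus f1 -> L1loc_Rplus f2 -> (0%:E < a)%E ->
  (forall V t : R, 0 < t -> F V t = f1 t + f2 t * V) ->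
  ivp_solution sigma lambda delta eta F a T <->
  (forall t : R, 0 <= t -> (t%:E < a)%E ->
    T t = (eta - lambda * \int[mu]_(tau in `[0, t])
            (f1 tau * expR (lambda * delta *
               (\int[mu]_(xi in `[0, tau]) f2 xi) - sigma * tau)))
          * expR (sigma * t - lambda * delta * \int[mu]_(tau in `[0, t]) f2 tau)).
Proof.
move=> if1 if2 a0 FE.
pose B (t : R) := \int[mu]_(xi in `[0, t]) f2 xi.
pose g2 (t : R) := sigma * t + - (lambda * delta) * B t.
pose k (t : R) := f1 t * expR (- g2 t).
pose K (t : R) := \int[mu]_(tau in `[0, t]) k tau.
pose g1 (t : R) := eta + - lambda * K t.
have acg2 b : 0 < b -> absolutely_continuous_on 0 b g2.
  move=> b0; apply: absolutely_continuousD; apply: absolutely_continuousZ.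
    exact: absolutely_continuous_id.
  exact: primitive_absolutely_continuous.
have acNg2 b : 0 < b -> absolutely_continuous_on 0 b (fun t => expR (- g2 t)).
  move=> b0; apply: absolutely_continuous_expR.
  apply: absolutely_continuous_ext (absolutely_continuousZ (-1) (acg2 _ b0)) _.
  by move=> x _; rewrite mulN1r.
have ik : L1loc_Rplus k by exact: L1loc_RplusM.
have acg1 b : 0 < b -> absolutely_continuous_on 0 b g1.
  move=> b0; apply: absolutely_continuousD; first exact: absolutely_continuous_cst.
  by apply: absolutely_continuousZ; exact: primitive_absolutely_continuous.
have dg2 (t : R) : is_derive t 1 B (f2 t) ->
    is_derive t 1 g2 (sigma - lambda * delta * f2 t).
  move=> dB; apply: (is_derive_eq (is_derive_funD
    (is_derive_funZ sigma (is_derive_id t 1)) (is_derive_funZ _ dB))).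
  by rewrite mulr1 mulNr.
have dg1 (t : R) : is_derive t 1 K (k t) -> is_derive t 1 g1 (- lambda * k t).
  move=> dK; apply: (is_derive_eq (is_derive_funD
    (is_derive_cst eta t 1) (is_derive_funZ (- lambda) dK))).
  by rewrite add0r.
have g10 : g1 0 = eta by rewrite /g1 /K set_itv1 Rintegral_set1 mulr0 addr0.
have g20 : g2 0 = 0 by rewrite /g2 /B set_itv1 Rintegral_set1 !mulr0 addr0.
have formulaE (t : R) : (eta - lambda * \int[mu]_(tau in `[0, t])
      (f1 tau * expR (lambda * delta *
        (\int[mu]_(xi in `[0, tau]) f2 xi) - sigma * tau)))
    * expR (sigma * t - lambda * delta * \int[mu]_(tau in `[0, t]) f2 tau) =
    g1 t * expR (g2 t).
  rewrite /g1 /g2 !mulNr; suff -> : K t = \int[mu]_(tau in `[0, t])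
      (f1 tau * expR (lambda * delta *
        (\int[mu]_(xi in `[0, tau]) f2 xi) - sigma * tau)) by [].
  by apply: eq_Rintegral => s _; rewrite /k /g2 opprD mulNr opprK addrC.
have dBK := @filterI _ _ (ae_filter_ringOfSetsType mu) _ _
  (is_derive_primitive if2) (is_derive_primitive ik).
rewrite ivp_solutionE; split => [[acT dT T0] t|TE].
  rewrite le_eqVlt formulaE => /predU1P[<- _|t0 ta].
    by rewrite T0 g10 g20 expR0 mulr1.
  (* In the derivative of the left side the terms in [sigma] and [f2] cancel, leaving
     [- lambda * k], which is also the derivative of [g1]. *)
  suff <- : T t * expR (- g2 t) = g1 t by rewrite -mulrA -expRD addNr expR0 mulr1.
  apply: (absolutely_continuous_derive_eq (f := fun t => T t * expR (- g2 t)) t0).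
  - by apply: absolutely_continuousM; [exact: acT|exact: acNg2].
  - exact: acg1.
  - apply: (@filterS _ _ (ae_filter_ringOfSetsType mu))
      (@filterI _ _ (ae_filter_ringOfSetsType mu) _ _ dT dBK).
    move=> s [{}dT [dB dK]] /andP[s0 st].
    exists (- lambda * k s); last exact/dg1/dK.
    have sa : (s%:E < a)%E by apply: lt_trans ta; rewrite lte_fin.
    have {}dT := dT s0 sa.
    have dE := is_derive_expR_comp (is_deriveN (dg2 _ (dB s0))).
    apply: (is_derive_eq (is_derive_funM dT dE)).
    rewrite FE// /k; ring.
  - by rewrite T0 g10 g20 oppr0 expR0 mulr1.
have {}TE (t : R) : 0 <= t -> (t%:E < a)%E -> T t = g1 t * expR (g2 t).
  by move=> t0 ta; rewrite TE// formulaE.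
split.
- move=> b b0 ba.
  apply: absolutely_continuous_ext (absolutely_continuousM (acg1 _ b0)
    (absolutely_continuous_expR (acg2 _ b0))) _.
  by move=> x /andP[x0 xb]; rewrite TE//; apply: le_lt_trans ba; rewrite lee_fin.
- apply: (@filterS _ _ (ae_filter_ringOfSetsType mu)) dBK => t [dB dK] t0 ta.
  apply: (is_derive_on_eq TE t0 ta).
  apply: (is_derive_eq (is_derive_funM (dg1 _ (dK t0))
    (is_derive_expR_comp (dg2 _ (dB t0))))).
  rewrite FE// TE ?(ltW t0)// /k expRN; field.
  by rewrite gt_eqF ?expR_gt0.
- by rewrite TE// g10 g20 expR0 mulr1.
Qed.

End ivp.

(** * The equation with a power nonlinearity *)

Section power_ivp.
Context {R : realType}.
Notation mu := (@lebesgue_measure R).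

(** Bernoulli's substitution turns the equation into one with a right-hand side free of [T].
    Positivity of [T] on one side corresponds to positivity of [G] on the other, so the powers are
    genuine throughout. *)
Lemma power_ivp_solution (sigma lambda delta eta n : R) (F : R -> R -> R)
    (f : R -> R) (a : \bar R) (T : R -> R) :
  n < 1 -> L1loc_Rplus f -> 0 < delta -> 0 < eta -> (0%:E < a)%E ->
  (forall V t : R, 0 < V -> 0 < t -> F V t = V `^ n * f t) ->
  let G (t : R) := eta `^ (1 - n) + lambda * delta `^ n * (n - 1) *
    \int[mu]_(tau in `[0, t]) (f tau * expR (sigma * (n - 1) * tau)) in
  (ivp_solution sigma lambda delta eta F a T /\
   (forall t : R, 0 <= t -> (t%:E < a)%E -> 0 < T t)) <->
  (forall t : R, 0 <= t -> (t%:E < a)%E ->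
    0 < G t /\ T t = G t `^ (1 / (1 - n)) * expR (sigma * t)).
Proof.
move=> n1 if_ delta0 eta0 a0 FE G.
have n10 : 1 - n != 0 by rewrite subr_eq0 gt_eqF.
pose k (t : R) := f t * expR (sigma * (n - 1) * t).
pose c := lambda * delta `^ n * (n - 1).
have acexp (b : R) :
    absolutely_continuous_on 0 b (fun t => expR (sigma * (n - 1) * t)).
  apply: absolutely_continuous_expR; apply: absolutely_continuousZ.
  exact: absolutely_continuous_id.
have ik : L1loc_Rplus k by exact: L1loc_RplusM.
have acG b : 0 < b -> absolutely_continuous_on 0 b G.
  move=> b0; apply: absolutely_continuousD; first exact: absolutely_continuous_cst.
  by apply: absolutely_continuousZ; exact: primitive_absolutely_continuous.
have dG : {ae mu, forall t : R, 0 < t -> is_derive t 1 G (c * k t)}.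
  apply: (@filterS _ _ (ae_filter_ringOfSetsType mu)) (is_derive_primitive ik).
  move=> t dK t0; apply: (is_derive_eq (is_derive_funD
    (is_derive_cst _ t 1) (is_derive_funZ c (dK t0)))).
  by rewrite add0r.
have G0 : G 0 = eta `^ (1 - n) by rewrite /G set_itv1 Rintegral_set1 mulr0 addr0.
have ltb_a (s b : R) : s <= b -> (b%:E < a)%E -> (s%:E < a)%E.
  by move=> sb; apply: le_lt_trans; rewrite lee_fin.
(* Both substitutions, from [T] to [G] and back, have the form [h ^ p] times [expR (q * s)], written
   here through [ln]. *)
have dexp (h : R -> R) (p q t dh : R) : 0 < h t -> is_derive t 1 h dh ->
    is_derive t 1 (fun s => expR (p * ln (h s) + q * s))
      (expR (p * ln (h t) + q * t) * (p * ((h t)^-1 * dh) + q)).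
  move=> ht0 dh'; apply: is_derive_expR_comp.
  apply: (is_derive_eq (is_derive_funD
    (is_derive_funZ p (is_derive_ln_comp ht0 dh'))
    (is_derive_funZ q (is_derive_id t 1)))).
  by rewrite mulr1.
have acexpln (h : R -> R) (p q b : R) : absolutely_continuous_on 0 b h ->
    (forall x, 0 <= x -> x <= b -> 0 < h x) ->
    absolutely_continuous_on 0 b (fun s => expR (p * ln (h s) + q * s)).
  move=> ach h0; apply: absolutely_continuous_expR; apply: absolutely_continuousD.
    by apply: absolutely_continuousZ; exact: absolutely_continuous_ln.
  by apply: absolutely_continuousZ; exact: absolutely_continuous_id.
have invE (x : R) : 0 < x -> x^-1 = expR (- ln x).
  by move=> x0; rewrite expRN lnK.
rewrite ivp_solutionE; split => [[[acT dT T0] Tpos] t t0 ta|GT].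
  (* This is [(T s * expR (- sigma * s)) ^ (1 - n)]. *)
  pose W (s : R) := expR ((1 - n) * ln (T s) + (n - 1) * sigma * s).
  suff WG : W t = G t.
    have Tt := Tpos _ t0 ta.
    rewrite -WG expR_gt0; split => //.
    rewrite powRE ?expR_gt0// expRK -expRD -[LHS]lnK//; congr expR.
    by field.
  move: t0 ta; rewrite le_eqVlt => /predU1P[<- _|t0 ta].
    by rewrite G0 /W T0 mulr0 addr0 powRE.
  apply: (absolutely_continuous_derive_eq t0).
  - apply: acexpln; first exact: acT.
    by move=> x x0 xt; apply: Tpos => //; exact: ltb_a ta.
  - exact: acG.
  - apply: (@filterS _ _ (ae_filter_ringOfSetsType mu))
      (@filterI _ _ (ae_filter_ringOfSetsType mu) _ _ dT dG).
    move=> s [{}dT {}dG] /andP[s0 st].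
    have sa : (s%:E < a)%E by exact: ltb_a (ltW st) ta.
    have Ts := Tpos _ (ltW s0) sa.
    exists (c * k s); last exact: dG.
    apply: (is_derive_eq (dexp _ (1 - n) ((n - 1) * sigma) _ _ Ts (dT s0 sa))).
    rewrite FE ?mulr_gt0// powRM ?ltW// /c /k (powRE n Ts) (invE _ Ts).
    set L := ln (T s).
    have -> : T s = expR L by rewrite lnK.
    (* The identity says that [W] times [T ^ (n - 1)] no longer involves [T], so the derivative of
       [W] is [c * k]. *)
    have -> : expR (sigma * (n - 1) * s) =
        expR ((1 - n) * L + (n - 1) * sigma * s) * expR (n * L) * expR (- L).
      by rewrite -!expRD; congr expR; ring.
    have LL : expR (- L) * expR L = 1 by rewrite -expRD addNr expR0.
    rewrite mulrBr mulrA [expR (- L) * _]mulrCA LL; ring.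
  - by rewrite G0 /W T0 mulr0 addr0 powRE.
pose M (s : R) := expR ((1 / (1 - n)) * ln (G s) + sigma * s).
have Gpos (t : R) : 0 <= t -> (t%:E < a)%E -> 0 < G t.
  by move=> t0 ta; have [] := GT _ t0 ta.
have TM (t : R) : 0 <= t -> (t%:E < a)%E -> T t = M t.
  move=> t0 ta; have [Gt ->] := GT _ t0 ta.
  by rewrite powRE// -expRD.
split; last by move=> t t0 ta; rewrite TM// expR_gt0.
split.
- move=> b b0 ba.
  apply: (@absolutely_continuous_ext _ _ _ M).
    apply: acexpln; first exact: acG.
    by move=> x x0 xb; apply: Gpos => //; exact: ltb_a ba.
  by move=> x /andP[x0 xb]; rewrite TM//; exact: ltb_a ba.
- apply: (@filterS _ _ (ae_filter_ringOfSetsType mu)) dG => t dG t0 ta.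
  apply: (is_derive_on_eq TM t0 ta).
  have Gt := Gpos _ (ltW t0) ta.
  apply: (is_derive_eq (dexp _ (1 / (1 - n)) sigma _ _ Gt (dG t0))).
  rewrite TM ?(ltW t0)// FE ?mulr_gt0 ?expR_gt0// powRM ?ltW ?expR_gt0//.
  rewrite (powRE n (expR_gt0 _)) expRK (invE _ Gt) /c /k -/(M t).
  set L := ln (G t).
  (* Computes [M ^ n], using [n / (1 - n) = 1 / (1 - n) - 1]. *)
  have -> : expR (n * (1 / (1 - n) * L + sigma * t)) =
      M t * expR (- L) * expR (sigma * (n - 1) * t).
    by rewrite -!expRD; congr expR; rewrite -/L; field.
  by field.
- rewrite TM// /M G0 mulr0 addr0 ln_powR mulrA mul1r mulVf// mul1r lnK//.
Qed.

End power_ivp.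

(** * Special exponents, constant coefficients and the three cases *)

Lemma rpow0 (R : realType) (x : R) : rpow x 0 = 1.
Proof. by rewrite /rpow int_num0 floor0 expr0z. Qed.

Lemma rpow1 (R : realType) (x : R) : rpow x 1 = x.
Proof. by rewrite /rpow int_num1 floor1 expr1z. Qed.

Lemma Rintegral_itv0_cst (R : realType) (c t : R) : 0 <= t ->
  \int[lebesgue_measure]_(s in `[0, t]) c = c * t.
Proof.
move=> t0; rewrite Rintegral_cst//; congr (_ * _).
apply: (congr1 fine (_ : @lebesgue_measure R `[0, t] = t%:E)).
rewrite lebesgue_measure_itv/= lte_fin; move: t0; rewrite le_eqVlt.
by move=> /predU1P[<-|->]; rewrite ?ltxx ?sube0.
Qed.

Theorem proposition2p1 (R : realType) (lambda eta delta sigma : R)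
    (lambda0 : lambda != 0) (eta0 : eta != 0) (delta0 : delta != 0)
    (F : R -> R -> R) (T : R -> R) :
  [/\
    (* 1 *)
    forall nu : R, nu != 0 ->
      (forall V t : R, 0 < t -> F V t = nu * V) ->
      ivp_solution sigma lambda delta eta F +oo%E T <->
      (forall t : R, 0 <= t ->
        T t = eta * expR ((sigma - lambda * nu * delta) * t)),
    (* 2 *)
    forall f1 f2 : R -> R, L1loc_Rplus f1 -> L1loc_Rplus f2 ->
      (forall V t : R, 0 < t -> F V t = f1 t + f2 t * V) ->
      let g1 (t : R) := eta - lambda *
        \int[lebesgue_measure]_(tau in `[0, t])
          (f1 tau * expR (lambda * delta *
             (\int[lebesgue_measure]_(xi in `[0, tau]) f2 xi) - sigma * tau)) in
      let g2 (t : R) := sigma * t - lambda * delta *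
        \int[lebesgue_measure]_(tau in `[0, t]) f2 tau in
      ivp_solution sigma lambda delta eta F +oo%E T <->
      (forall t : R, 0 <= t -> T t = g1 t * expR (g2 t))
  & (* 3: [0, a[ is any interval, possibly [0, +oo[, on which V^n is
       meaningful along V = delta * T t *)
    forall (n : R) (f : R -> R), n < 1 ->
      (forall t : R, 0 < t -> 0 < f t) -> L1loc_Rplus f ->
      0 < lambda -> 0 < delta -> 0 < eta ->
      (forall V t : R, 0 < t -> F V t = rpow V n * f t) ->
      let G (t : R) := rpow eta (1 - n) + lambda * rpow delta n * (n - 1) *
        \int[lebesgue_measure]_(tau in `[0, t])
          (f tau * expR (sigma * (n - 1) * tau)) in
      let g (t : R) := rpow (G t) (1 / (1 - n)) in
      forall a : \bar R, (0%:E < a)%E ->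
        (ivp_solution sigma lambda delta eta F a T /\
         (forall t : R, 0 <= t -> (t%:E < a)%E -> n != 0 -> 0 < T t)) <->
        (forall t : R, 0 <= t -> (t%:E < a)%E ->
          (n != 0 -> 0 < G t) /\ T t = g t * expR (sigma * t))].
Proof.
split.
- move=> nu _ FE.
  (* The first case is the linear one with [f1 = 0] and constant [f2 = nu]. *)
  rewrite (linear_ivp_solution sigma lambda delta eta T
      (L1loc_Rplus_cst 0) (L1loc_Rplus_cst nu) (ltry 0)
      (fun V t t0 => etrans (FE V t t0) (esym (add0r (nu * V))))).
  have E (t : R) : 0 <= t ->
      (eta - lambda * \int[lebesgue_measure]_(tau in `[0, t])
      (0 * expR (lambda * delta *
             (\int[lebesgue_measure]_(xi in `[0, tau]) nu) - sigma * tau))) *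
      expR (sigma * t - lambda * delta * \int[lebesgue_measure]_(tau in `[0, t]) nu)
      = eta * expR ((sigma - lambda * nu * delta) * t).
    move=> t0; under eq_Rintegral do rewrite mul0r.
    rewrite !Rintegral_itv0_cst// mul0r mulr0 subr0; congr (_ * expR _); ring.
  by split=> TE t t0 => [|_]; rewrite TE ?E ?ltry.
- move=> f1 f2 if1 if2 FE g1 g2.
  rewrite (linear_ivp_solution sigma lambda delta eta T if1 if2 (ltry 0) FE).
  by split=> TE t t0 => [|_]; rewrite TE ?ltry.
move=> n f n1 f0 if_ lambda_gt0 delta_gt0 eta_gt0 FE G g a a0.
(* For nonzero [n] positivity is part of both sides and [rpow] agrees with the real power at every
   base involved. *)
have [n0|n0] := eqVneq n 0; last first.
  have FE' (V t : R) : 0 < V -> 0 < t -> F V t = V `^ n * f t.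
    by move=> V0 t0; rewrite FE// rpow_gt0E.
  have solE : ivp_solution sigma lambda delta eta F a T /\
        (forall t : R, 0 <= t -> (t%:E < a)%E -> 0 < T t) <->
      (forall t : R, 0 <= t -> (t%:E < a)%E ->
        0 < G t /\ T t = G t `^ (1 / (1 - n)) * expR (sigma * t)).
    by rewrite /G !rpow_gt0E//; exact: power_ivp_solution.
  split=> [[solT Tpos] t t0 ta|GT].
    have [|Gt ->] := solE.1 _ t t0 ta; last by split=> //; rewrite /g rpow_gt0E.
    by split=> // s s0 sa; exact: Tpos.
  have [|solT Tpos] := solE.2; last by split=> // t t0 ta _; exact: Tpos.
  move=> t t0 ta; have [/(_ isT) Gt ->] := GT t t0 ta.
  by split=> //; rewrite /g rpow_gt0E.
(* For exponent zero the equation is linear with [f1 = f] and [f2 = 0]. As [rpow _ 1] is the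
   identity at every sign, the formula remains valid where [G] is not positive. *)
rewrite {}n0 in G g FE *.
have FE' (V t : R) : 0 < t -> F V t = f t + 0 * V.
  by move=> t0; rewrite FE// rpow0 mul1r mul0r addr0.
have H := linear_ivp_solution sigma lambda delta eta T if_ (L1loc_Rplus_cst 0) a0 FE'.
have gE (t : R) : 0 <= t ->
      (eta - lambda * \int[lebesgue_measure]_(tau in `[0, t])
      (f tau * expR (lambda * delta *
             (\int[lebesgue_measure]_(xi in `[0, tau]) 0) - sigma * tau))) *
      expR (sigma * t - lambda * delta * \int[lebesgue_measure]_(tau in `[0, t]) 0)
      = g t * expR (sigma * t).
  move=> t0; rewrite Rintegral_itv0_cst// mul0r mulr0 subr0; congr (_ * _).
  rewrite /g /G subr0 divr1 !rpow1 rpow0 sub0r mulr1 mulrN1 mulNr; congr (_ - _ * _).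
  apply: eq_Rintegral => s; rewrite inE/= in_itv/= => /andP[s0 _].
  by rewrite Rintegral_itv0_cst// mul0r mulr0 sub0r mulrN1 mulNr.
split=> [[/H solT _] t t0 ta|gT].
  by split=> [/eqP//|]; rewrite solT// gE.
split; last by move=> t _ _ /eqP.
by apply/H => t t0 ta; rewrite gE//; have [] := gT t t0 ta.
Qed.
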